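(* Let $\mathfrak{g}=\mathfrak{h}\rtimes_D\mathbb{R}$ be a four-dimensional almost abelian real Lie algebra with basis $\{e_1,e_2,e_3,e_4\}$, $\mathfrak{h}=\mathrm{span}_{\mathbb R}\{e_1,e_2,e_3\}$, $D=\mathrm{ad}(e_4)|_{\mathfrak{h}}$, with metric $g=e^1\otimes e^1+e^2\otimes e^2-e^3\otimes e^3-e^4\otimes e^4$, and suppose that $$D=\begin{pmatrix} d_{11}&d_{12}&d_{12}\\ d_{21}&d_{22}&-d_{11}+d_{22}\\ -d_{21}&d_{32}&d_{11}+d_{32}\end{pmatrix},$$ $$\varphi=\varphi_1e^1+\varphi_2(e^2+e^3)+(\varphi_1+d_{11}+d_{22}+d_{32})e^4,$$ $$H=2d_{11}e^{123}-(d_{12}+d_{21})(e^{124}+e^{134})+(d_{11}-d_{22}-d_{32})e^{234},$$ with real parameters satisfying $d_{11}\mathrm{Tr}(D)=0$, $d_{11}\varphi_1=0$, $d_{12}\varphi_1+(d_{22}+d_{32})\varphi_2=0$. Assume that $\mathfrak{g}$ is non-unimodular and that $\varphi$ and $H$ are non-zero. Then $(\mathfrak{g},g,\varphi,H)$ solves $$\mathrm{Ric}^g+\nabla^g\varphi-\tfrac12H\circ H=0,\qquad \delta H+\iota_{\varphi^\sharp}H=0,\qquad \delta\varphi+\langle\varphi,\varphi\rangle-\langle H,H\rangle=0$$ if and only if, for some non-zero real number $t$, $$D=\begin{pmatrix}0&d_{12}&d_{12}\\ 0&\frac{1}{2t}(t^2-d_{12}^2)&\frac{1}{2t}(t^2-d_{12}^2)\\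 0&\frac{1}{2t}(t^2+d_{12}^2)&\frac{1}{2t}(t^2+d_{12}^2)\end{pmatrix}$$ and $$\varphi=-te^1+d_{12}(e^2+e^3),\qquad H=-d_{12}(e^{124}+e^{134})-te^{234}=\mathrm{d}\left(e^{23}+\tfrac{d_{12}}{t}(e^{12}+e^{13})\right).$$ In particular, in that case $\mathfrak{g}\cong\mathbb{R}^2\oplus\mathfrak{aff}(\mathbb{R})$, where $\mathfrak{aff}(\mathbb{R})$ is the Lie algebra of the group of affine motions of the real line.
   Context: Almost abelian: $\mathfrak{g}$ is non-abelian with codimension-one abelian ideal $\mathfrak{h}$. Brackets: $[e_i,e_j]=0$, $[e_4,e_i]=De_i=d_{1i}e_1+d_{2i}e_2+d_{3i}e_3$ for $i,j\in\{1,2,3\}$, $D=(d_{ij})$. $\mathfrak{g}$ is unimodular iff $\mathrm{Tr}(D)=0$. $\{e^i\}$ is the dual basis, $e^{ab\cdots}=e^a\wedge e^b\wedge\cdots$, $\mathrm{d}$ is the Chevalley-Eilenberg differential ($\mathrm{d}\theta(X,Y)=-\theta([X,Y])$). All objects are regarded as left-invariant objects on the simply connected Lie group of $\mathfrak{g}$, oriented by $e^{1234}$. $\nabla^g$ is the Levi-Civita connection, $\mathrm{Ric}^g$ the Ricci tensor, $\langle-,-\rangle$ the metric induced by $g$ on forms (determinant convention on decomposables), $(H\circ H)(X,Y)=\langle\iota_XH,\iota_YH\rangle$, $\delta=-*\mathrm{d}*$ the codifferential with $\beta\wedge*\gamma=\langle\beta,\gamma\rangle e^{1234}$, and $\varphi^\sharp$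 the $g$-dual vector of $\varphi$. *)

(* Defs.v *)
From HB Require Import structures.
From mathcomp Require Import all_boot all_order all_fingroup all_algebra.
From mathcomp Require Import ring.
From mathcomp Require Import boolp functions reals.

Set Implicit Arguments.
Unset Strict Implicit.
Unset Printing Implicit Defensive.

Import Order.TTheory GRing.Theory Num.Theory.
Local Open Scope ring_scope.

Section LieAlgebra.
Variable R : realType.
Implicit Types U V W : lmodType R.

Definition is_lie_bracket V (br : V -> V -> V) :=
  [/\ forall z, linear (br^~ z), forall x, linear (br x), forall x, br x x = 0
    & forall x y z, br x (br y z) + br y (br z x) + br z (br x y) = 0].

Definition abelian_bracket V (br : V -> V -> V) := forall x y, br x y = 0.

Definition lie_isomorphic U V (brU : U -> U -> U) (brV : V -> V -> V) :=
  exists f : {linear U -> V},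
    bijective f /\ {morph f : x y / brU x y >-> brV x y}.

Definition abelian_sum_bracket U V (brV : V -> V -> V) (x y : U * V) : U * V :=
  (0, brV x.2 y.2).

(* The affine motion s |-> a s + b is the matrix [[a, b], [0, 1]], so the Lie
   algebra aff(R) consists of the matrices [[a, b], [0, 0]], here identified
   with their first row (a, b), under the matrix commutator. *)
Definition aff_mx (u : 'rV[R]_2) : 'M[R]_(1 + 1) := col_mx u 0.

Definition aff_bracket (u v : 'rV[R]_2) : 'rV[R]_2 :=
  usubmx (aff_mx u *m aff_mx v - aff_mx v *m aff_mx u).

Lemma aff_bracketE u v :
  aff_mx (aff_bracket u v) = aff_mx u *m aff_mx v - aff_mx v *m aff_mx u.
Proof.
by rewrite /aff_mx /aff_bracket !mul_col_mx !mul0mx opp_col_mx add_col_mx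
           subr0 col_mxKu.
Qed.

Lemma aff_bracket_lie : is_lie_bracket aff_bracket.
Proof.
have aff_inj : injective aff_mx by move=> u v /eq_col_mx[].
have affP a u v : aff_mx (a *: u + v) = a *: aff_mx u + aff_mx v.
  by rewrite /aff_mx scale_col_mx add_col_mx scaler0 addr0.
have affD u v : aff_mx (u + v) = aff_mx u + aff_mx v.
  by rewrite -[u]scale1r affP !scale1r.
split=> [z a u v|x a u v|x|x y z]; apply: aff_inj.
- rewrite affP !aff_bracketE affP mulmxDl mulmxDr -scalemxAl -scalemxAr.
  by rewrite scalerBr opprD addrACA.
- rewrite affP !aff_bracketE affP mulmxDl mulmxDr -scalemxAl -scalemxAr.
  by rewrite scalerBr opprD addrACA.
- by rewrite aff_bracketE subrr /aff_mx col_mx0.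
rewrite !affD !aff_bracketE /aff_mx col_mx0 -/(aff_mx x) -/(aff_mx y)
        -/(aff_mx z).
rewrite !mulmxBr !mulmxBl !mulmxA.
set A := aff_mx x *m aff_mx y *m aff_mx z.
set B := aff_mx x *m aff_mx z *m aff_mx y.
set C := aff_mx y *m aff_mx z *m aff_mx x.
set E := aff_mx y *m aff_mx x *m aff_mx z.
set F := aff_mx z *m aff_mx x *m aff_mx y.
set G := aff_mx z *m aff_mx y *m aff_mx x.
by apply/matrixP=> i j; rewrite !mxE; ring.
Qed.

End LieAlgebra.

(* Left-invariant tensors on a Lie group whose Lie algebra is ('rV_n, br), in
   the basis e_k = delta_mx 0 k; G is the Gram matrix of the metric. *)
Section LeftInvariantGeometry.
Variables (R : realType) (n : nat) (G : 'M[R]_n).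
Variable br : 'rV[R]_n -> 'rV[R]_n -> 'rV[R]_n.
Implicit Types x y z : 'rV[R]_n.

Definition unimodular := forall x, \tr (lin1_mx (br x)) = 0.

(* A p-form takes its p arguments as the rows of a matrix. *)
Definition pform p := 'M[R]_(p, n) -> R^o.

Definition alternating p (b : pform p) :=
  forall (s : 'S_p) X, b (row_perm s X) = (-1) ^+ s * b X.

Definition wedge p q (b : pform p) (c : pform q) : pform (p + q) := fun X =>
  (p`! * q`!)%:R^-1 * \sum_(s : 'S_(p + q))
    (-1) ^+ s * b (usubmx (row_perm s X)) * c (dsubmx (row_perm s X)).

Definition interior p x (b : pform p.+1) : pform p := fun X => b (col_mx x X).

(* For alternating b this is the Chevalley-Eilenberg differential
     \sum_(i < j) (-1)^(i + j) b([X_i, X_j], X_0, ..., X_p)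
   with X_i and X_j omitted; moving [X_i, X_j] to position i costs (-1)^i. *)
Definition extd p (b : pform p) : pform p.+1 := fun X =>
  \sum_(i < p.+1) \sum_(j < p.+1 | (i < j)%N) (-1) ^+ j *
    b (row' j (\matrix_(k < p.+1)
                 if k == i then br (row i X) (row j X) else row k X)).

Definition metric x y : R := (x *m G *m y^T) 0 0.

Definition sharp (phi : pform 1) : 'rV[R]_n :=
  (\row_k phi (delta_mx 0 k)) *m invmx G.

(* Full contraction over p!, where row k of invmx G is the g-dual vector of
   e^k; this is the determinant convention, see inner_decomposable. *)
Definition inner p (b c : pform p) : R :=
  p`!%:R^-1 * \sum_(I : {ffun 'I_p -> 'I_n})
    b (rowsub I 1%:M) * c (rowsub I (invmx G)).

(* ( *c)(Y) = <vol(-, Y), c> for the volume form vol = e^{1...n}, i.e. \det;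
   only meaningful for p + q = n, when conform_mx is the identity.
   See wedge_hodge. *)
Definition hodge p q (c : pform p) : pform q := fun Y =>
  inner (fun X => \det (conform_mx (0 : 'M_n) (col_mx X Y))) c.

(* The sign is the one for even n. *)
Definition codiff p (b : pform p.+1) : pform p :=
  - hodge (extd (hodge b : pform (n - p.+1))).

(* Koszul formula for left-invariant fields; see nabla_torsion_free and
   nabla_metric. *)
Definition nabla x y : 'rV[R]_n := sharp (fun z =>
  2^-1 * (metric (br x y) z - metric (br y z) x + metric (br z x) y)).

(* R(x, y) z = nabla_x nabla_y z - nabla_y nabla_x z - nabla_[x, y] z, and
   Ric(x, y) = tr (z |-> R(z, x) y). *)
Definition curvature x y z : 'rV[R]_n :=
  nabla x (nabla y z) - nabla y (nabla x z) - nabla (br x y) z.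

Definition ricci x y : R := \tr (lin1_mx (fun z => curvature z x y)).

(* (nabla_x phi)(y) for a left-invariant 1-form phi. *)
Definition cov_deriv (phi : pform 1) x y : R := - phi (nabla x y).

Definition circ (H : pform 3) x y : R :=
  @inner 2 (interior x H) (interior y H).

Definition solves (phi : pform 1) (H : pform 3) :=
  [/\ forall x y, ricci x y + cov_deriv phi x y - 2^-1 * circ H x y = 0,
      codiff H + interior (sharp phi) H = 0 :> pform 2
    & codiff phi 0 + inner phi phi - inner H H = 0].

Lemma inner_decomposable p (A B : 'M[R]_(p, n)) :
  inner (fun X => \det (X *m A^T)) (fun X => \det (X *m B^T)) =
  \det (A *m invmx G *m B^T).
Proof.
set N := invmx G *m B^T.
have rowsubM m k l (f : 'I_m -> 'I_k) (M : 'M[R]_(k, l)) :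
    rowsub f 1%:M *m M = rowsub f M.
  by apply/matrixP=> i j; rewrite -{2}[M]mul1mx !mxE; apply: eq_bigr => ? _;
     rewrite !mxE.
have -> : \det (A *m invmx G *m B^T) =
    \sum_(I : {ffun 'I_p -> 'I_n}) (\prod_i A i (I i)) * \det (rowsub I N).
  rewrite -mulmxA -/N /determinant.
  under eq_bigr => s _.
    under eq_bigr do rewrite !mxE.
    rewrite bigA_distr_bigA /= mulr_sumr; over.
  rewrite exchange_big /=; apply: eq_bigr => I _; rewrite mulr_sumr.
  apply: eq_bigr => s _; rewrite big_split /= mulrCA; congr (_ * (_ * _)).
  by apply: eq_bigr => i _; rewrite !mxE.
rewrite /inner.
under eq_bigr => I _.
  rewrite rowsubM.
  have -> : rowsub I (invmx G) *m B^T = rowsub I N.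
    by rewrite -[rowsub I (invmx G)]rowsubM -mulmxA rowsubM.
  rewrite -[\det (rowsub I A^T)]det_tr [X in X * _]/determinant mulr_suml; over.
rewrite exchange_big /= (eq_bigr (fun=>
   \sum_(I : {ffun 'I_p -> 'I_n}) (\prod_i A i (I i)) * \det (rowsub I N))).
  rewrite sumr_const /= (_ : #|_| = p`!%N); last by rewrite -card_Sn; apply: eq_card => s; rewrite inE.
  rewrite -[X in _ * X]mulr_natl mulrA mulVf ?mul1r //.
  by rewrite pnatr_eq0 -lt0n fact_gt0.
move=> s _.
have ffK (t : 'S_p) : cancel (fun I : {ffun 'I_p -> 'I_n} => [ffun i => I (t i)])
                             (fun I => [ffun i => I (t^-1%g i)]).
  by move=> I; apply/ffunP => i; rewrite !ffunE permKV.
have ffK' (t : 'S_p) : cancel (fun I : {ffun 'I_p -> 'I_n} => [ffun i => I (t^-1%g i)])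
                             (fun I => [ffun i => I (t i)]).
  by move=> I; apply/ffunP => i; rewrite !ffunE permK.
rewrite [RHS](reindex _ (onW_bij _ (Bijective (ffK s) (ffK' s)))) /=.
apply: eq_bigr => I _; rewrite mulrAC -mulrA mulrC.
have -> : rowsub [ffun i => I (s i)] N = row_perm s (rowsub I N).
  by apply/matrixP => i j; rewrite !mxE ffunE.
rewrite row_permE det_mulmx det_perm.
under [in RHS]eq_bigr do rewrite ffunE.
under eq_bigr do rewrite !mxE.
by set P := \prod_(i < p) _; set d := \det _; set e := (-1) ^+ s; ring.
Qed.

Lemma metric_sharp (phi : pform 1) z : G \in unitmx -> linear phi ->
  metric (sharp phi) z = phi z.
Proof.
move=> Gu phiL; rewrite /metric /sharp mulmxKV //.
pose f : {linear 'rV[R]_n -> R^o} := HB.pack phi (GRing.isLinear.Build _ _ _ _ phi phiL).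
rewrite -[phi]/(f : _ -> _) {2}[z]row_sum_delta linear_sum mxE.
by apply: eq_bigr => k _; rewrite linearZ !mxE mulrC.
Qed.

Lemma metricC x y : G^T = G -> metric x y = metric y x.
Proof.
move=> Gs; have -> : metric x y = ((x *m G *m y^T)^T) 0 0 by rewrite mxE.
by rewrite !trmx_mul trmxK Gs mulmxA.
Qed.

Lemma metric_linear x : linear (metric x : _ -> R^o).
Proof.
by move=> a u v; rewrite /metric linearP /= linearP [LHS]mxE [X in X + _]mxE.
Qed.

Section LeviCivita.
Hypotheses (G_sym : G^T = G) (G_unit : G \in unitmx) (br_lie : is_lie_bracket br).

Lemma metric_nabla x y z : metric (nabla x y) z =
  2^-1 * (metric (br x y) z - metric (br y z) x + metric (br z x) y).
Proof.
have [brl brr _ _] := br_lie; apply: metric_sharp => // a u v.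
have -> : br (a *: u + v) x = a *: br u x + br v x by exact: brl.
rewrite brr [metric _ x]metricC // [metric _ y]metricC // !metric_linear.
rewrite [metric _ (br u x)]metricC // [metric _ (br v x)]metricC //.
rewrite [metric x (br y u)]metricC // [metric x (br y v)]metricC //.
by rewrite /GRing.scale /=; ring.
Qed.

Lemma metric_inj x y : (forall z, metric x z = metric y z) -> x = y.
Proof.
move=> xy; apply: (can_inj (mulmxK G_unit)); apply/rowP => k.
have := xy (delta_mx 0 k); rewrite /metric trmx_delta.
by rewrite -!colE !mxE.
Qed.

Lemma lie_bracketC x y : br x y = - br y x.
Proof.
have [brl brr br0 _] := br_lie; apply/eqP; rewrite -addr_eq0 -(br0 (x + y)).
by rewrite -[x in br (x + _)]scale1r brl -[X in br x (X + _)]scale1r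
           -[X in br y (X + _)]scale1r !brr !scale1r !br0 add0r addr0.
Qed.

Lemma nabla_torsion_free x y : nabla x y - nabla y x = br x y.
Proof.
apply: metric_inj => z; rewrite metricC // -scaleN1r addrC metric_linear.
rewrite !(metricC z) // !metric_nabla (lie_bracketC y x) (lie_bracketC z y)
        (lie_bracketC z x).
have mN u v : metric (- u) v = - metric u v.
  by rewrite /metric !mulNmx mxE.
by rewrite !mN /GRing.scale /=; field.
Qed.

Lemma nabla_metric x y z : metric (nabla x y) z + metric y (nabla x z) = 0.
Proof.
rewrite (metricC y) // !metric_nabla (lie_bracketC z y) (lie_bracketC z x)
        (lie_bracketC x y).
have mN u v : metric (- u) v = - metric u v.
  by rewrite /metric !mulNmx mxE.
by rewrite !mN; ring.
Qed.

End LeviCivita.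
End LeftInvariantGeometry.

Section WedgeHodge.
Variables (R : realType) (p q : nat) (G : 'M[R]_(p + q)).
Implicit Types (s t u w : 'S_(p + q)) (I : {ffun 'I_p -> 'I_(p + q)}).

Lemma rowsub_det (J : 'I_(p + q) -> 'I_(p + q)) :
  \det (rowsub J 1%:M : 'M[R]__) =
  \sum_(s : 'S_(p + q)) (-1) ^+ s *+ [forall i, J i == s i].
Proof.
apply: eq_bigr => s _; case: forallP => [Js|nJs]; rewrite ?mulr0n.
  by rewrite big1 ?mulr1// => i _; rewrite !mxE (Js i).
have /forallPn/= [i nJsi] : ~~ [forall i, J i == s i] by apply/forallP.
by rewrite (bigD1 i) //= !mxE (negPf nJsi) mul0r mulr0.
Qed.

Lemma perm_restrict u : (forall k, u (rshift p k) = rshift p k) ->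
  exists v : 'S_p, (forall i, u (lshift q i) = lshift q (v i)) /\ odd_perm u = v.
Proof.
move=> ur; have ul i : exists j, u (lshift q i) = lshift q j.
  case: (split_ordP (u (lshift q i))) => [j ->|k uk]; first by exists j.
  by move: uk; rewrite -(ur k) => /perm_inj/eqP; rewrite eq_lrshift.
have [f uf] := choice ul.
have f_inj : injective f.
  by move=> i j fij; apply: (@lshift_inj p q); apply: (@perm_inj _ u); rewrite !uf fij.
exists (perm f_inj); split=> [i|]; first by rewrite permE.
have: \det (perm_mx u : 'M[R]_(p + q)) = \det (perm_mx (perm f_inj) : 'M[R]_p).
  rewrite -[RHS]mulr1 -[X in _ * X](det1 R q) -(det_ublock _ 0); congr (\det _).
  apply/matrixP => i j.
  case: (split_ordP i) => k ->; case: (split_ordP j) => l ->;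
    rewrite ?(block_mxEul, block_mxEur, block_mxEdl, block_mxEdr) !mxE ?uf ?ur
            ?permE ?(eq_lrshift, eq_rlshift) //.
    by rewrite (inj_eq (@rshift_inj _ _)).
by rewrite !det_perm => /signr_inj.
Qed.

Lemma perm_extend I : injective I -> exists t, forall i, t (lshift q i) = I i.
Proof.
move=> I_inj; pose C := [set k | k \notin codom I].
have cardC : #|C| = q.
  have := cardsC C; rewrite card_ord addnC.
  have -> : #|~: C| = p.
    rewrite -[RHS]card_ord -(card_codom I_inj); apply: eq_card => k.
    by rewrite !inE negbK.
  by move/addnI.
pose g k := match fintype.split k with
  | inl i => I i | inr j => enum_val (cast_ord (esym cardC) j) end.
have gl i : g (lshift q i) = I i by rewrite /g -[lshift q i]/(unsplit (inl _)) unsplitK.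
have gr j : g (rshift p j) \notin codom I.
  rewrite /g -[rshift p j]/(unsplit (inr _)) unsplitK.
  by have := enum_valP (cast_ord (esym cardC) j); rewrite inE.
have g_inj : injective g.
  move=> k l; case: (split_ordP k) => i ->; case: (split_ordP l) => j ->.
  - by rewrite !gl => /I_inj ->.
  - by rewrite gl => Ig; have := gr j; rewrite -Ig codom_f.
  - by rewrite gl => gI; have := gr i; rewrite gI codom_f.
  rewrite /g -[rshift p i]/(unsplit (inr _)) -[rshift p j]/(unsplit (inr _)).
  by rewrite !unsplitK => /enum_val_inj/cast_ord_inj ->.
by exists (perm g_inj) => i; rewrite permE gl.
Qed.

Lemma wedge_hodge (b c : pform R (p + q) p) : alternating b ->
  wedge b (hodge G c : pform R (p + q) q) 1%:M = inner G b c.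
Proof.
move=> b_alt.
pose bI I := b (rowsub I 1%:M).
pose A I t := [forall i, I i == t (lshift q i)].
pose B s t := [forall j, s (rshift p j) == t (rshift p j)].
have onl u : perm_on [set lshift q i | i in 'I_p] u =
             [forall j, u (rshift p j) == rshift p j].
  apply/subsetP/forallP => [uL j|ur k].
    apply/contraT => /uL /imsetP[i _ /eqP]; by rewrite eq_rlshift.
  case: (split_ordP k) => i -> {k}; first by rewrite imset_f.
  by rewrite inE (eqP (ur i)) eqxx.
have onr u : perm_on [set rshift p j | j in 'I_q] u =
             [forall i, u (lshift q i) == lshift q i].
  apply/subsetP/forallP => [uL j|ur k].
    apply/contraT => /uL /imsetP[i _ /eqP]; by rewrite eq_lrshift.
  case: (split_ordP k) => i -> {k}; last by rewrite imset_f.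
  by rewrite inE (eqP (ur i)) eqxx.
have detE I s : \det (conform_mx (0 : 'M[R]_(p + q))
      (col_mx (rowsub I 1%:M) (dsubmx (row_perm s 1%:M)))) =
    \sum_(t | A I t && B s t) (-1) ^+ t.
  rewrite conform_mx_id.
  pose J k := match fintype.split k with inl i => I i | inr j => s (rshift p j) end.
  have -> : col_mx (rowsub I 1%:M) (dsubmx (row_perm s 1%:M)) =
            rowsub J 1%:M :> 'M[R]_(p + q).
    apply/matrixP => k l; rewrite !mxE /J.
    by case: (fintype.split k) => i; rewrite !mxE.
  rewrite rowsub_det [RHS]big_mkcond /=; apply: eq_bigr => t _.
  rewrite -mulrb; congr (_ *+ nat_of_bool _).
  apply/forallP/andP => [Jt|[/forallP It /forallP st] k].
    split; apply/forallP => i.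
      by have := Jt (unsplit (inl i)); rewrite /J unsplitK.
    by have := Jt (unsplit (inr i)); rewrite /J unsplitK.
  by rewrite /J -[k in t k]splitK; case: (fintype.split k).
have inner_sum I t : A I t -> \sum_(s | B s t)
    (-1) ^+ s * b (usubmx (row_perm s 1%:M)) * (-1) ^+ t = bI I *+ p`!.
  move=> /forallP It.
  have mulK : {on [pred s | B s t], bijective (fun u => (u * t)%g)}.
    by exists (fun s => (s * t^-1)%g) => s _; rewrite -mulgA ?mulVg ?mulgV mulg1.
  rewrite (reindex _ mulK) /=.
  rewrite (eq_bigl (perm_on [set lshift q i | i in 'I_p])); last first.
    move=> u; rewrite onl; apply: eq_forallb => j.
    by rewrite permM (inj_eq perm_inj).
  rewrite (eq_bigr (fun=> bI I)); last first.
    move=> u; rewrite onl => /forallP ur.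
    have [v [uv sgn_uv]] := perm_restrict (fun k => eqP (ur k)).
    have -> : usubmx (row_perm (u * t)%g 1%:M) = row_perm v (rowsub I 1%:M) :> 'M[R]_(p, _).
      apply/matrixP => i j; rewrite !mxE permM uv.
      by rewrite -(eqP (It (v i))).
    rewrite b_alt odd_permM sgn_uv signr_addb -/(bI I).
    by case: (odd_perm v); case: (odd_perm t); rewrite /= ?expr0 ?expr1; ring.
  rewrite sumr_const card_perm card_imset ?card_ord //; exact: lshift_inj.
have outer_sum I : \sum_(t | A I t) bI I *+ p`! = (p`! * q`!)%:R * bI I.
  have [/injectiveP I_inj|/injectivePn[i [j ij Iij]]] := boolP (injectiveb I).
    have [t0 t0I] := perm_extend I_inj.
    have mulK : {on [pred t | A I t], bijective (fun u => (u * t0)%g)}.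
      by exists (fun s => (s * t0^-1)%g) => s _; rewrite -mulgA ?mulVg ?mulgV mulg1.
    rewrite (reindex _ mulK) /=.
    rewrite (eq_bigl (perm_on [set rshift p j | j in 'I_q])); last first.
      move=> u; rewrite onr; apply: eq_forallb => j.
      by rewrite permM -t0I (inj_eq perm_inj) eq_sym.
    rewrite sumr_const card_perm card_imset ?card_ord; last exact: rshift_inj.
    by rewrite -mulrnA mulr_natl.
  suff -> : bI I = 0 by rewrite mulr0 big1 // => t _; rewrite mul0rn.
  have bN : bI I = - bI I.
    rewrite {1}/bI; have -> : rowsub I 1%:M = row_perm (tperm i j) (rowsub I 1%:M) :> 'M[R]_(p, _).
      by apply/matrixP => k l; rewrite !mxE; case: tpermP => // ->; rewrite Iij.
    by rewrite b_alt odd_tperm ij expr1 mulN1r.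
  have: bI I *+ 2 == 0 by rewrite mulr2n {1}bN addNr.
  by rewrite mulrn_eq0 => /eqP.
have nz : (p`! * q`!)%:R != 0 :> R.
  by rewrite pnatr_eq0 -lt0n muln_gt0 !fact_gt0.
apply: (mulfI nz); rewrite /wedge mulrA mulfV // mul1r /hodge /inner.
rewrite mulrCA mulr_sumr.
under eq_bigr => s _.
  rewrite mulrCA mulr_sumr; under eq_bigr => I _.
    rewrite detE mulrA mulr_sumr mulr_suml; over.
  over.
rewrite -mulr_sumr -[LHS]mulr_sumr; congr (_ * _); rewrite mulr_sumr.
rewrite exchange_big /=; apply: eq_bigr => I _.
rewrite mulrA -outer_sum mulr_suml.
under [RHS]eq_bigr => t It do rewrite -(inner_sum _ _ It) mulr_suml.
rewrite (exchange_big_dep (A I)) /=; last by move=> s t _ /andP[].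
apply: eq_bigr => t It; apply: eq_bigl => s.
by rewrite It.
Qed.
End WedgeHodge.

Section AlmostAbelian.
Variable R : realType.

(* The semidirect product of the abelian ideal h spanned by e_1, e_2, e_3 with
   R e_4: [e_4, e_i] = D e_i, the i-th column of D. *)
Definition almost_abelian_bracket (D : 'M[R]_3) (x y : 'rV[R]_4) : 'rV[R]_4 :=
  let h (v : 'rV[R]_(3 + 1)) := lsubmx v in
  row_mx (x 0 ord_max *: (h y *m D^T) - y 0 ord_max *: (h x *m D^T)) (0 : 'rV_1).

(* e^{ab...} for 1-based indices a, b, ... in {1, ..., 4}. *)
Definition coframe (s : seq nat) : pform R 4 (size s) := fun X =>
  \det (\matrix_(i < size s, j < size s) X i (inord (nth 0%N s j).-1)).

Definition neutral_metric : 'M[R]_4 :=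
  diag_mx (\row_(i < 4) if (i < 2)%N then 1 else -1).

Definition mx33 (s : seq (seq R)) : 'M[R]_3 :=
  \matrix_(i < 3, j < 3) (nth [::] s i)`_j.

Let last4 : (ord_max : 'I_4) = rshift 3 (ord0 : 'I_1).
Proof. exact: val_inj. Qed.

Lemma almost_abelian_lie D : is_lie_bracket (almost_abelian_bracket D).
Proof.
pose br x y : 'rV_(3 + 1) := almost_abelian_bracket D x y.
have br_h x y : lsubmx (br x y) =
    x 0 ord_max *: (lsubmx (y : 'rV_(3 + 1)) *m D^T)
    - y 0 ord_max *: (lsubmx (x : 'rV_(3 + 1)) *m D^T).
  exact: row_mxKl.
have br_4 x y : br x y 0 ord_max = 0.
  by rewrite /br /almost_abelian_bracket last4 row_mxEr mxE.
have eq4 (x y : 'rV[R]_(3 + 1)) :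
    lsubmx x = lsubmx y -> x 0 ord_max = y 0 ord_max -> x = y.
  move=> h_eq; rewrite last4 => eq_4; rewrite -[x]hsubmxK -[y]hsubmxK h_eq.
  congr row_mx; apply/rowP => i; by rewrite !mxE !ord1.
have hP a (x y : 'rV[R]_(3 + 1)) :
    lsubmx (a *: x + y) *m D^T = a *: (lsubmx x *m D^T) + lsubmx y *m D^T.
  by rewrite linearP /= mulmxDl scalemxAl.
have br_lP a x y z : br (a *: x + y) z = a *: br x z + br y z.
  apply: eq4; last by rewrite [RHS]mxE [X in _ = X + _]mxE !br_4 mulr0 addr0.
  rewrite [RHS]linearP /= !br_h hP.
  by apply/rowP => i; rewrite !mxE; ring.
have brC x y : br x y = - br y x.
  apply: eq4; last by rewrite [RHS]mxE !br_4 oppr0.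
  by rewrite linearN /= !br_h opprB.
split=> [z a x y|x a y z|x|x y z].
- exact: br_lP.
- by rewrite -[LHS]/(br _ _) brC br_lP opprD -scalerN -!brC.
- by rewrite -[LHS]/(br x x); apply: eq4; rewrite ?br_4 ?mxE // br_h subrr linear0.
rewrite -[LHS]/(br x (br y z) + br y (br z x) + br z (br x y)).
apply: eq4; last by rewrite mxE [X in X + _]mxE !br_4 mxE !addr0.
rewrite !linearD linear0  /= !br_h !br_4 !scale0r !subr0.
by rewrite !mulmxBl -!scalemxAl; apply/rowP => i; rewrite !mxE; ring.
Qed.

Lemma almost_abelian_unimodular D :
  unimodular (almost_abelian_bracket D) <-> \tr D = 0.
Proof.
have trE x : \tr (lin1_mx (almost_abelian_bracket D x)) = x 0 ord_max * \tr D.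
  rewrite /mxtrace (@big_split_ord _ _ _ 3 1) /= big_ord1.
  rewrite [X in _ + X]mxE [X in _ + X]row_mxEr [X in _ + X]mxE addr0 mulr_sumr.
  apply: eq_bigr => i _; rewrite mxE [LHS]row_mxEl.
  have -> : lsubmx (delta_mx 0 (lshift 1 i) : 'rV[R]_(3 + 1)) = delta_mx 0 i.
    by apply/rowP => j; rewrite !mxE (inj_eq (@lshift_inj _ _)).
  have -> : (delta_mx 0 (lshift 1 i) : 'rV[R]_(3 + 1)) 0 ord_max = 0.
    by rewrite last4 mxE eq_rlshift andbF.
  by rewrite scale0r subr0 -rowE !mxE.
split=> [/(_ (delta_mx 0 ord_max))|D0 x]; first by rewrite trE mxE !eqxx mul1r.
by rewrite trE D0 mulr0.
Qed.

Lemma neutral_metric_unit : neutral_metric \in unitmx.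
Proof.
rewrite unitmxE det_diag unitfE; apply/prodf_neq0 => i _.
by rewrite mxE; case: ifP => _; rewrite ?oppr_eq0 oner_neq0.
Qed.

Lemma neutral_metric_sym : neutral_metric^T = neutral_metric.
Proof. exact: tr_diag_mx. Qed.

End AlmostAbelian.

Notation "''e^[' a ; .. ; b ]" := (@coframe _ (cons a%N .. (cons b%N nil) ..))
  (at level 0, a, b at level 99, format "''e^[' a ;  .. ;  b ]").

(* Main.v *)
From HB Require Import structures.
Require Import Defs.
From mathcomp Require Import all_boot all_order all_fingroup all_algebra.
From mathcomp Require Import ring.
From mathcomp Require Import boolp functions reals.
Set Implicit Arguments.
Unset Strict Implicit.
Unset Printing Implicit Defensive.
Import Order.TTheory GRing.Theory Num.Theory.
Local Open Scope ring_scope.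

(** Since [\tr D <> 0] and [d11 * \tr D = 0], one has [d11 = 0], and then [D]
    annihilates the null vector [e_2 - e_3]: writing [p, q, r, s] for
    [d12, d21, d22, d32], only the matrix [null_mx p q r s] matters, and
    [u = r + s] is its trace.  In this family everything is a short polynomial.
    With [phi = alpha e^1 + beta (e^2 + e^3) + gamma e^4] and
    [H = a (e^124 + e^134) + b e^234],
    - [codiff H + i_(phi^sharp) H] has the components [b p - a u - a gamma] on
      [e^12] and [e^13], [- b gamma] on [e^23], and [a alpha + b beta] on [e^24]
      and [e^34] ([gauge_equationE]);
    - the scalar equation is [- gamma u + alpha^2 - gamma^2 - b^2 = 0]
      ([dilaton_equationE]);
    - the Ricci tensor, the covariant derivative of [phi] and [H o H] are the
      bilinear forms of [ricciE], [cov_derivE] and [circE].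

    In the theorem [a = - (p + q)], [b = - u] and [gamma = alpha + u], with
    [u <> 0].  The [e^23] component of the second equation reads
    [u gamma = 0], so [gamma = 0] and [alpha = - u].  The [e^12] component then
    reads [u q = 0], so [q = 0]; the hypothesis [p alpha + u beta = 0] gives
    [beta = p].  Finally the Einstein equation at [(e_2, e_3)] has become
    [p^2 + (r - s) u = 0].  These four conditions make all the equations hold
    ([solves_iff]), and [t = u] turns them into the normal form of the theorem:
    [2 t r = u (u + (r - s)) = t^2 - p^2], and likewise for [s].

    For [q = 0] the image of [D] is the line of the eigenvector [(p, r, s)],
    with eigenvalue [u], so the Lie algebra is a plane of central elements plus
    the non-abelian algebra spanned by [e_4 / u] and that vector
    ([null_mx_isomorphic]).

    The calculus of forms rests on one fact: pairing an alternating form with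
    [e^J] in an orthonormal basis evaluates it, up to sign, at the vectors [e_J]
    ([inner_coordinate_form]).  It turns the sums over all multi-indices in
    the inner product and in the Hodge star into one term for each basis form. *)

(** * Pairing with basis forms *)

Section Pairing.
Variables (R : realType) (n : nat) (G : 'M[R]_n).

Definition coordinate_form p (J : 'I_p -> 'I_n) : pform R n p :=
  fun X => \det (colsub J X).

Lemma innerD p (b c d : pform R n p) :
  inner G b (c + d) = inner G b c + inner G b d.
Proof.
rewrite /inner -mulrDr; congr (_ * _); rewrite -big_split /=.
by apply: eq_bigr => I _; rewrite -mulrDr.
Qed.

Lemma innerZ p (b c : pform R n p) k : inner G b (k *: c) = k * inner G b c.
Proof.
rewrite /inner mulrCA; congr (_ * _); rewrite mulr_sumr.
by apply: eq_bigr => I _; rewrite mulrCA.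
Qed.

Lemma alternatingD p (c d : pform R n p) :
  alternating c -> alternating d -> alternating (c + d).
Proof. by move=> ac ad s X; rewrite -[LHS]/(c _ + d _) ac ad -mulrDr. Qed.

Lemma alternatingZ p (c : pform R n p) k :
  alternating c -> alternating (k *: c).
Proof.
move=> ac s X; rewrite -[LHS]/(k * c _) -[(k *: c) X]/(k * c X) ac.
exact: mulrCA.
Qed.

Lemma alternating_coordinate_form p (J : 'I_p -> 'I_n) :
  alternating (coordinate_form J).
Proof.
move=> s X; rewrite /coordinate_form.
have -> : colsub J (row_perm s X) = row_perm s (colsub J X).
  by apply/matrixP => i j; rewrite !mxE.
by rewrite row_permE det_mulmx det_perm.
Qed.

(** Expanding the determinant, a multi-index [I] contributes for [s] only when
    [I = J \o s], because the metric is diagonal; reordering the arguments of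
    [b] cancels the sign of [s], and the [p`!] equal terms cancel the
    normalisation. *)
Lemma inner_coordinate_form p (J : 'I_p -> 'I_n) (b : pform R n p)
    (w : 'rV[R]_n) :
  invmx G = diag_mx w -> alternating b ->
  inner G b (coordinate_form J) = (\prod_i w 0 (J i)) * b (rowsub J 1%:M).
Proof.
move=> Gw b_alt; rewrite /inner /coordinate_form Gw.
under [X in _ * X = _]eq_bigr => I _ do rewrite /determinant mulr_sumr.
rewrite exchange_big /=.
rewrite [X in _ * X = _](eq_bigr
  (fun=> (\prod_i w 0 (J i)) * b (rowsub J 1%:M))); last first.
  move=> s _; rewrite (bigD1 [ffun i => J (s i)]) //= [X in _ + X]big1 ?addr0.
    have -> : rowsub [ffun i => J (s i)] 1%:M =
              row_perm s (rowsub J 1%:M) :> 'M[R]_(p, n).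
      by apply/matrixP => i j; rewrite !mxE ffunE.
    rewrite b_alt; under eq_bigr do rewrite !mxE ffunE eqxx mulr1n.
    rewrite -(reindex_inj (F := fun i => w 0 (J i)) (P := xpredT)
                          (@perm_inj _ s)) /=.
    by rewrite mulrACA -expr2 sqrr_sign mul1r mulrC.
  move=> I nI; have [i nIi] : exists i, I i != J (s i).
    apply/existsP; apply: contraNT nI; rewrite negb_exists => /forallP IJ.
    apply/eqP/ffunP => i; rewrite ffunE; apply/eqP.
    by have := IJ i; rewrite negbK.
  by rewrite (bigD1 i) //= !mxE (negPf nIi) mulr0n mul0r !mulr0.
rewrite sumr_const /= (_ : #|_| = p`!%N); last first.
  by rewrite -card_Sn; apply: eq_card => s; rewrite inE.
rewrite -[X in _ * X]mulr_natl mulrA mulVf ?mul1r //.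
by rewrite pnatr_eq0 -lt0n fact_gt0.
Qed.

End Pairing.

(** This is the form that the Hodge star of a [p]-form pairs with. *)
Lemma alternating_det_col (R : realType) p q (Y : 'M[R]_(q, p + q)) :
  alternating (fun X : 'M_(p, p + q) =>
    \det (conform_mx (0 : 'M_(p + q)) (col_mx X Y)) : R^o).
Proof.
move=> s X; rewrite !conform_mx_id.
have -> : col_mx (row_perm s X) Y =
          block_mx (perm_mx s) 0 0 1%:M *m col_mx X Y.
  by rewrite mul_block_col mul0mx addr0 mul0mx add0r mul1mx row_permE.
by rewrite det_mulmx det_ublock det_perm det1 mulr1.
Qed.

(** * Small sums and determinants *)

Section SmallDimensions.
Variable R : realType.

Lemma sum3E (V : zmodType) (F : 'I_3 -> V) :
  \sum_(i < 3) F i = F (inord 0) + F (inord 1) + F (inord 2).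
Proof.
rewrite !big_ord_recl big_ord0 addr0 !addrA.
by congr (F _ + F _ + F _); apply: val_inj; rewrite /= inordK.
Qed.

Lemma sum4E (V : zmodType) (F : 'I_4 -> V) :
  \sum_(i < 4) F i = F (inord 0) + F (inord 1) + F (inord 2) + F (inord 3).
Proof.
rewrite !big_ord_recl big_ord0 addr0 !addrA.
by congr (F _ + F _ + F _ + F _); apply: val_inj; rewrite /= inordK.
Qed.

Lemma sum_lt2 (V : zmodType) (F : nat -> nat -> V) :
  \sum_(i < 2) \sum_(j < 2 | (i < j)%N) F i j =
  F 0%N 1%N.
Proof.
under eq_bigr do rewrite big_mkcond.
by rewrite !big_ord_recl !big_ord0 /= !add0r !addr0 ?addrA.
Qed.

Lemma sum_lt3 (V : zmodType) (F : nat -> nat -> V) :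
  \sum_(i < 3) \sum_(j < 3 | (i < j)%N) F i j =
  F 0%N 1%N + F 0%N 2%N + F 1%N 2%N.
Proof.
under eq_bigr do rewrite big_mkcond.
by rewrite !big_ord_recl !big_ord0 /= !add0r !addr0 ?addrA.
Qed.

Lemma sum_lt4 (V : zmodType) (F : nat -> nat -> V) :
  \sum_(i < 4) \sum_(j < 4 | (i < j)%N) F i j =
  F 0%N 1%N + F 0%N 2%N + F 0%N 3%N + F 1%N 2%N + F 1%N 3%N
  + F 2%N 3%N.
Proof.
under eq_bigr do rewrite big_mkcond.
by rewrite !big_ord_recl !big_ord0 /= !add0r !addr0 ?addrA.
Qed.

(** Minors of the first two or three rows, of a matrix given as a function on
    [nat]: when that function computes on numerals, so does the minor, and a
    determinant is expanded by reduction instead of rewriting. *)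
Definition minor2 (x : nat -> nat -> R) (i j : nat) :=
  x 0%N i * x 1%N j - x 0%N j * x 1%N i.

Definition minor3 (x : nat -> nat -> R) (i j k : nat) :=
  x 0%N i * minor2 (fun l => x l.+1) j k
  - x 0%N j * minor2 (fun l => x l.+1) i k
  + x 0%N k * minor2 (fun l => x l.+1) i j.

Lemma det2E (M : 'M[R]_2) (x : nat -> nat -> R) :
  (forall i j, (i < 2)%N -> (j < 2)%N -> M (inord i) (inord j) = x i j) ->
  \det M = minor2 x 0 1.
Proof.
move=> Mx; have ME i j : M i j = x i j by rewrite -Mx // !inord_val.
rewrite (expand_det_row _ ord0) !big_ord_recl big_ord0 /cofactor !det_mx11.
by rewrite !mxE !ME /= /bump /= /minor2; ring.
Qed.

Lemma det3E (M : 'M[R]_3) (x : nat -> nat -> R) :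
  (forall i j, (i < 3)%N -> (j < 3)%N -> M (inord i) (inord j) = x i j) ->
  \det M = minor3 x 0 1 2.
Proof.
move=> Mx; have ME i j : M i j = x i j by rewrite -Mx // !inord_val.
rewrite (expand_det_row _ ord0) !big_ord_recl big_ord0 /cofactor.
rewrite !(det2E (fun _ _ _ _ => erefl)) /minor3 /minor2 !mxE !ME /= /bump /=.
by rewrite !inordK //=; ring.
Qed.

Lemma det4E (M : 'M[R]_4) (x : nat -> nat -> R) (y := fun i => x i.+1) :
  (forall i j, (i < 4)%N -> (j < 4)%N -> M (inord i) (inord j) = x i j) ->
  \det M = x 0%N 0%N * minor3 y 1 2 3 - x 0%N 1%N * minor3 y 0 2 3
         + x 0%N 2%N * minor3 y 0 1 3 - x 0%N 3%N * minor3 y 0 1 2.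
Proof.
move=> Mx; have ME i j : M i j = x i j by rewrite -Mx // !inord_val.
rewrite (expand_det_row _ ord0) !big_ord_recl big_ord0 /cofactor.
rewrite !(det3E (fun _ _ _ _ => erefl)) /y /minor3 /minor2 !mxE !ME /= /bump /=.
by rewrite !inordK //=; ring.
Qed.

Lemma ord4P (P : 'I_4 -> Prop) :
  P (inord 0) -> P (inord 1) -> P (inord 2) -> P (inord 3) -> forall i, P i.
Proof.
move=> P0 P1 P2 P3 i; rewrite -(inord_val i).
by case: i => [[|[|[|[|k]]]] h].
Qed.

End SmallDimensions.

(** * Vectors, connection and curvature *)

Local Notation "x # k" := (x 0 (inord k))
  (at level 2, k at level 1, format "x # k").

Section Coordinates.
Variable R : realType.
Local Notation g := (neutral_metric R).

(** Geometric operations are computed on vectors given by their coordinates, so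
    that nested applications reduce by rewriting from the inside. *)
Definition vec (a b c d : R) : 'rV[R]_4 := \row_i nth 0 [:: a; b; c; d] i.

Lemma vec_inord a b c d k : (k < 4)%N ->
  (vec a b c d)#k = nth 0 [:: a; b; c; d] k.
Proof. by move=> k4; rewrite mxE inordK. Qed.

Lemma vec0 a b c d : (vec a b c d)#0 = a. Proof. exact: vec_inord. Qed.
Lemma vec1 a b c d : (vec a b c d)#1 = b. Proof. exact: vec_inord. Qed.
Lemma vec2 a b c d : (vec a b c d)#2 = c. Proof. exact: vec_inord. Qed.
Lemma vec3 a b c d : (vec a b c d)#3 = d. Proof. exact: vec_inord. Qed.
Definition vecE := (vec0, vec1, vec2, vec3).

Lemma vec_coord (x : 'rV[R]_4) : x = vec x#0 x#1 x#2 x#3.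
Proof. by apply/rowP; elim/ord4P; rewrite vecE. Qed.

Lemma vecB a b c d a' b' c' d' :
  vec a b c d - vec a' b' c' d' = vec (a - a') (b - b') (c - c') (d - d').
Proof.
by rewrite [LHS]vec_coord; congr vec; rewrite mxE [X in _ + X]mxE !vecE.
Qed.

Lemma row_vec m (X : 'M[R]_(m, 4)) i :
  row i X =
  vec (X i (inord 0)) (X i (inord 1)) (X i (inord 2)) (X i (inord 3)).
Proof. by rewrite [LHS]vec_coord !mxE. Qed.

Lemma delta_inord i j : (i < 4)%N -> (j < 4)%N ->
  (delta_mx 0 (inord i) : 'rV[R]_4)#j = (i == j)%:R.
Proof. by move=> ? ?; rewrite mxE eqxx -val_eqE /= !inordK // eq_sym. Qed.

Lemma delta0 : delta_mx 0 (inord 0) = vec 1 0 0 0.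
Proof. by rewrite [LHS]vec_coord !delta_inord. Qed.
Lemma delta1 : delta_mx 0 (inord 1) = vec 0 1 0 0.
Proof. by rewrite [LHS]vec_coord !delta_inord. Qed.
Lemma delta2 : delta_mx 0 (inord 2) = vec 0 0 1 0.
Proof. by rewrite [LHS]vec_coord !delta_inord. Qed.
Lemma delta3 : delta_mx 0 (inord 3) = vec 0 0 0 1.
Proof. by rewrite [LHS]vec_coord !delta_inord. Qed.
Definition deltaE := (delta0, delta1, delta2, delta3).

Definition neutral_sign : 'rV[R]_4 := \row_i if (i < 2)%N then 1 else -1.

Lemma neutral_invmx : invmx g = diag_mx neutral_sign.
Proof.
rewrite -[LHS]mulmx1.
have <- : g *m g = 1%:M.
  rewrite mulmx_diag -diag_const_mx; congr diag_mx; apply/rowP => i.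
  by rewrite !mxE; case: ifP => _; ring.
by rewrite mulmxA mulVmx ?neutral_metric_unit // mul1mx.
Qed.

Lemma neutral_metricE (x y : 'rV[R]_4) :
  metric g x y = x#0 * y#0 + x#1 * y#1 - x#2 * y#2 - x#3 * y#3.
Proof. by rewrite /metric mul_mx_diag mxE sum4E !mxE !inordK //=; ring. Qed.

Lemma neutral_sharpE (f : pform R 4 1) k :
  sharp g f 0 k = f (delta_mx 0 k) * neutral_sign 0 k.
Proof. by rewrite /sharp neutral_invmx mul_mx_diag !mxE. Qed.

Lemma bracket_ideal (D : 'M[R]_3) (x y : 'rV[R]_4) k (v := fun z : 'rV[R]_4 =>
    D (inord k) (inord 0) * z#0 + D (inord k) (inord 1) * z#1
    + D (inord k) (inord 2) * z#2) :
  (k < 3)%N -> (almost_abelian_bracket D x y)#k = x#3 * v y - y#3 * v x.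
Proof.
move=> k3.
have liftE j : (j < 3)%N -> inord j = lshift 1 (inord j : 'I_3) :> 'I_4.
  by move=> j3; apply: val_inj; rewrite /= !inordK // (leq_trans j3).
have maxE : ord_max = inord 3 :> 'I_4 by apply: val_inj; rewrite /= inordK.
rewrite liftE // [LHS]row_mxEl maxE !mxE !sum3E !mxE -!liftE //.
by rewrite /v; ring.
Qed.

Lemma bracket_transverse D (x y : 'rV[R]_4) :
  (almost_abelian_bracket D x y)#3 = 0.
Proof.
have -> : inord 3 = rshift 3 (ord0 : 'I_1) :> 'I_4.
  by apply: val_inj; rewrite /= inordK.
by rewrite [LHS]row_mxEr mxE.
Qed.

Definition null_mx (p q r s : R) : 'M[R]_3 :=
  mx33 [:: [:: 0; p; p]; [:: q; r; r]; [:: - q; s; s]].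

Lemma null_mx_trace p q r s : \tr (null_mx p q r s) = r + s.
Proof. by rewrite /mxtrace sum3E !mxE !inordK //= add0r. Qed.

Section Curvature.
Variables p q r s : R.
Local Notation br := (almost_abelian_bracket (null_mx p q r s)).

Lemma bracketE x0 x1 x2 x3 y0 y1 y2 y3
    (l := x3 * y0 - y3 * x0) (m := x3 * (y1 + y2) - y3 * (x1 + x2)) :
  br (vec x0 x1 x2 x3) (vec y0 y1 y2 y3) =
  vec (p * m) (q * l + r * m) (- q * l + s * m) 0.
Proof.
rewrite [LHS]vec_coord bracket_transverse !bracket_ideal // !vecE.
by rewrite !mxE !inordK //= /l /m; congr vec; ring.
Qed.

Lemma nablaE x0 x1 x2 x3 y0 y1 y2 y3 :
  nabla g br (vec x0 x1 x2 x3) (vec y0 y1 y2 y3) =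
  vec ((p - q) / 2 * x3 * (y1 + y2) - (p + q) / 2 * (x1 + x2) * y3)
      (- ((p + q) / 2) * x0 * y3 - (p - q) / 2 * x3 * y0
        + (r + s) / 2 * x3 * y2 - (r * x1 + (r - s) / 2 * x2) * y3)
      ((p + q) / 2 * x0 * y3 + (p - q) / 2 * x3 * y0
        + (r + s) / 2 * x3 * y1 + ((r - s) / 2 * x1 - s * x2) * y3)
      (- ((p + q) / 2) * (x0 * (y1 + y2) + (x1 + x2) * y0)
        - r * x1 * y1 + s * x2 * y2 - (r - s) / 2 * (x1 * y2 + x2 * y1)).
Proof.
rewrite [LHS]vec_coord /nabla !neutral_sharpE !mxE !inordK //=.
rewrite !deltaE !bracketE.
by rewrite !neutral_metricE !vecE; congr vec; field.
Qed.

Lemma ricciE x0 x1 x2 x3 y0 y1 y2 y3 :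
  ricci g br (vec x0 x1 x2 x3) (vec y0 y1 y2 y3) =
  (r + s) * (p / 2 + q) * (x0 * (y1 + y2) + (x1 + x2) * y0)
  + ((p ^+ 2 - q ^+ 2) / 2 + (r - s) * (r + s)) * ((x1 + x2) * (y1 + y2))
  + (r + s) ^+ 2 / 2 * (x1 * y1 - x2 * y2 - x3 * y3).
Proof.
rewrite /ricci /mxtrace sum4E ![lin1_mx _ _ _]mxE !deltaE /curvature.
rewrite !(nablaE, bracketE) !vecB !vecE.
by field.
Qed.

End Curvature.

(** * Forms in the coordinate basis *)

Definition form1 (a b c d : R) : pform R 4 1 :=
  a *: 'e^[1] + b *: 'e^[2] + c *: 'e^[3] + d *: 'e^[4].

Definition form2 (a b c d e f : R) : pform R 4 2 :=
  a *: 'e^[1; 2] + b *: 'e^[1; 3] + c *: 'e^[1; 4] + d *: 'e^[2; 3] +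
  e *: 'e^[2; 4] + f *: 'e^[3; 4].

Definition form3 (a b c d : R) : pform R 4 3 :=
  a *: 'e^[1; 2; 3] + b *: 'e^[1; 2; 4] + c *: 'e^[1; 3; 4]
  + d *: 'e^[2; 3; 4].

Lemma form1E a b c d X :
  form1 a b c d X = a * X#0 + b * X#1 + c * X#2 + d * X#3.
Proof. by rewrite /form1 !fctE /coframe !det_mx11 !mxE. Qed.

Lemma form2E a b c d e f (X : 'M[R]_(2, 4)) (x : nat -> nat -> R) :
  (forall i j, (i < 2)%N -> (j < 4)%N -> X (inord i) (inord j) = x i j) ->
  form2 a b c d e f X =
  a * minor2 x 0 1 + b * minor2 x 0 2 + c * minor2 x 0 3
    + d * minor2 x 1 2 + e * minor2 x 1 3 + f * minor2 x 2 3.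
Proof.
move=> Xx; rewrite /form2 !fctE /coframe !(det2E (fun _ _ _ _ => erefl)).
by rewrite /minor2 !mxE /= !inordK //= !Xx.
Qed.

Lemma form3E a b c d (X : 'M[R]_(3, 4)) (x : nat -> nat -> R) :
  (forall i j, (i < 3)%N -> (j < 4)%N -> X (inord i) (inord j) = x i j) ->
  form3 a b c d X =
  a * minor3 x 0 1 2 + b * minor3 x 0 1 3 + c * minor3 x 0 2 3
    + d * minor3 x 1 2 3.
Proof.
move=> Xx; rewrite /form3 !fctE /coframe !(det3E (fun _ _ _ _ => erefl)).
by rewrite /minor3 /minor2 !mxE /= !inordK //= !Xx.
Qed.

Lemma alternating_coframe s : alternating (@coframe R s).
Proof.
have -> : @coframe R s =
    coordinate_form (fun j : 'I_(size s) => inord (nth 0%N s j).-1).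
  by apply/funext => X; congr (\det _); apply/matrixP => i j; rewrite !mxE.
exact: alternating_coordinate_form.
Qed.

Lemma alternating_form1 a b c d : alternating (form1 a b c d).
Proof.
by do ! apply: alternatingD; apply: alternatingZ;
   apply: (@alternating_coframe [:: _]).
Qed.

Lemma alternating_form2 a b c d e f : alternating (form2 a b c d e f).
Proof.
by do ! apply: alternatingD; apply: alternatingZ;
   apply: (@alternating_coframe [:: _; _]).
Qed.

Lemma alternating_form3 a b c d : alternating (form3 a b c d).
Proof.
by do ! apply: alternatingD; apply: alternatingZ;
   apply: (@alternating_coframe [:: _; _; _]).
Qed.

(** The rows are the basis vectors dual to the factors of [coframe s], hence the
    same shift from 1-based indices. *)
Definition frame (s : seq nat) : 'M[R]_(size s, 4) :=
  rowsub (fun i => inord (nth 0%N s i).-1) 1%:M.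

Lemma frameE k s i j :
  (i < (size s).+1)%N -> (j < 4)%N -> all (fun l => l.-1 < 4)%N (k :: s) ->
  frame (k :: s) (inord i) (inord j) = ((nth 0%N (k :: s) i).-1 == j)%:R.
Proof.
move=> i_s j4 /allP s4; rewrite !mxE -val_eqE /= !inordK //.
by apply: s4; rewrite mem_nth.
Qed.

Lemma frame1E k j (l := k.-1) : (l < 4)%N -> (j < 4)%N ->
  frame [:: k] 0 (inord j) = (l == j)%:R.
Proof. by move=> ? ?; rewrite !mxE -val_eqE /= !inordK. Qed.

Lemma inner_coframe (s : seq nat) (b : pform R 4 (size s)) : alternating b ->
  inner g b (@coframe R s) =
  (\prod_(i < size s) neutral_sign 0 (inord (nth 0%N s i).-1)) * b (frame s).
Proof.
move=> b_alt; rewrite -(inner_coordinate_form _ neutral_invmx b_alt).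
by congr inner; apply/funext => X; congr (\det _).
Qed.

Lemma inner_form1r (b : pform R 4 1) a1 a2 a3 a4 : alternating b ->
  inner g b (form1 a1 a2 a3 a4) =
  a1 * b (frame [:: 1]) + a2 * b (frame [:: 2]) - a3 * b (frame [:: 3])
  - a4 * b (frame [:: 4]).
Proof.
move=> b_alt; rewrite /form1 !innerD !innerZ !(@inner_coframe [:: _]) //.
by rewrite !big_ord_recl !big_ord0 !mxE /= !inordK //=; ring.
Qed.

Lemma inner_form2r (b : pform R 4 2) a1 a2 a3 a4 a5 a6 : alternating b ->
  inner g b (form2 a1 a2 a3 a4 a5 a6) =
  a1 * b (frame [:: 1; 2]) - a2 * b (frame [:: 1; 3])
  - a3 * b (frame [:: 1; 4]) - a4 * b (frame [:: 2; 3])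
  - a5 * b (frame [:: 2; 4]) + a6 * b (frame [:: 3; 4]).
Proof.
move=> b_alt; rewrite /form2 !innerD !innerZ !(@inner_coframe [:: _; _]) //.
by rewrite !big_ord_recl !big_ord0 !mxE /= !inordK //=; ring.
Qed.

Lemma inner_form3r (b : pform R 4 3) a1 a2 a3 a4 : alternating b ->
  inner g b (form3 a1 a2 a3 a4) =
  - a1 * b (frame [:: 1; 2; 3]) - a2 * b (frame [:: 1; 2; 4])
  + a3 * b (frame [:: 1; 3; 4]) + a4 * b (frame [:: 2; 3; 4]).
Proof.
move=> b_alt; rewrite /form3 !innerD !innerZ !(@inner_coframe [:: _; _; _]) //.
by rewrite !big_ord_recl !big_ord0 !mxE /= !inordK //=; ring.
Qed.

Lemma inner_volr (b : pform R 4 4) a : alternating b ->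
  inner g b (a *: 'e^[1; 2; 3; 4]) = a * b (frame [:: 1; 2; 3; 4]).
Proof.
move=> b_alt; rewrite innerZ (@inner_coframe [:: _; _; _; _]) //.
by rewrite !big_ord_recl !big_ord0 !mxE /= !inordK //=; ring.
Qed.

Lemma inner_form1 a b c d a' b' c' d' :
  inner g (form1 a b c d) (form1 a' b' c' d') =
  a * a' + b * b' - c * c' - d * d'.
Proof.
rewrite inner_form1r; last exact: alternating_form1.
by rewrite !form1E !frame1E //=; ring.
Qed.

Lemma inner_form2 a b c d e f a' b' c' d' e' f' :
  inner g (form2 a b c d e f) (form2 a' b' c' d' e' f') =
  a * a' - b * b' - c * c' - d * d' - e * e' + f * f'.
Proof.
rewrite inner_form2r; last exact: alternating_form2.
have frE k l kl4 := form2E a b c d e f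
  (fun i j i2 j4 => @frameE k [:: l] i j i2 j4 kl4).
by rewrite !frE // /minor2 /=; ring.
Qed.

Lemma inner_form3 a b c d a' b' c' d' :
  inner g (form3 a b c d) (form3 a' b' c' d') =
  - a * a' - b * b' + c * c' + d * d'.
Proof.
rewrite inner_form3r; last exact: alternating_form3.
have frE k l m klm4 := form3E a b c d
  (fun i j i3 j4 => @frameE k [:: l; m] i j i3 j4 klm4).
by rewrite !frE // /minor3 /minor2 /=; ring.
Qed.

Lemma sharp_form1 a b c d : sharp g (form1 a b c d) = vec a b (- c) (- d).
Proof.
rewrite [LHS]vec_coord !neutral_sharpE !deltaE !form1E !vecE !mxE !inordK //=.
by congr vec; ring.
Qed.

Lemma col_mx_top m1 m2 n (A : 'M[R]_(m1.+1, n)) (B : 'M_(m2, n)) k j :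
  (k < m1.+1)%N -> col_mx A B (inord k : 'I_(m1 + m2).+1) j = A (inord k) j.
Proof.
move=> km; rewrite -(col_mxEu A B); congr (col_mx A B _ j).
apply: val_inj; rewrite /= !inordK //; apply: leq_trans km _.
by rewrite ltnS leq_addr.
Qed.

Lemma col_mx_bot m1 m2 n (A : 'M[R]_(m1.+1, n)) (B : 'M_(m2.+1, n)) k j :
  (m1 < k < m1.+1 + m2.+1)%N ->
  col_mx A B (inord k : 'I_(m1 + m2.+1).+1) j = B (inord (k - m1.+1)) j.
Proof.
case/andP=> mk km; rewrite -(col_mxEd A B); congr (col_mx A B _ j).
by apply: val_inj; rewrite /= !inordK ?subnKC // ltn_subLR.
Qed.

Lemma interior_form3 x0 x1 x2 x3 a b c d :
  interior (vec x0 x1 x2 x3) (form3 a b c d) =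
  form2 (a * x2 + b * x3) (c * x3 - a * x1) (- b * x1 - c * x2)
        (a * x0 + d * x3) (b * x0 - d * x2) (c * x0 + d * x1).
Proof.
apply/funext => X; rewrite /interior (form3E _ _ _ _ (fun _ _ _ _ => erefl)).
rewrite (form2E _ _ _ _ _ _ (fun _ _ _ _ => erefl)) /minor3 /minor2.
rewrite !(@col_mx_top 0 2 _ _ _ 0) // !(@col_mx_bot 0 1) //.
by rewrite !(ord1 (inord 0)) !vecE; ring.
Qed.

Lemma col_frameE k s m (Y : 'M[R]_(m.+1, 4)) i j :
  (i < (size s).+1 + m.+1)%N -> (j < 4)%N ->
  all (fun l => l.-1 < 4)%N (k :: s) ->
  col_mx (frame (k :: s)) Y (inord i : 'I_(size s + m.+1).+1) (inord j) =
  if (i < (size s).+1)%N then ((nth 0%N (k :: s) i).-1 == j)%:R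
  else Y (inord (i - (size s).+1)) (inord j).
Proof.
move=> im j4 s4; case: ltnP => [is_|si]; last by rewrite col_mx_bot ?si.
by rewrite col_mx_top // frameE.
Qed.

Lemma hodge_form1 a b c d :
  hodge g (form1 a b c d) = form3 d (- c) (- b) a :> pform R 4 3.
Proof.
apply/funext => Y; rewrite /hodge inner_form1r; last first.
  exact: (@alternating_det_col R 1 3).
have detE k k4 :=
  det4E (fun i j i4 j4 => @col_frameE k [::] 2 Y i j i4 j4 k4).
rewrite !(@conform_mx_id _ 4 4) !detE //=.
rewrite (form3E _ _ _ _ (fun _ _ _ _ => erefl)) /minor3 /minor2 /=.
by ring.
Qed.

Lemma hodge_form2 a b c d e f :
  hodge g (form2 a b c d e f) = form2 f e (- d) (- c) b a :> pform R 4 2.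
Proof.
apply/funext => Y; rewrite /hodge inner_form2r; last first.
  exact: (@alternating_det_col R 2 2).
have detE k l kl4 :=
  det4E (fun i j i4 j4 => @col_frameE k [:: l] 1 Y i j i4 j4 kl4).
rewrite !(@conform_mx_id _ 4 4) !detE //=.
rewrite (form2E _ _ _ _ _ _ (fun _ _ _ _ => erefl)) /minor3 /minor2 /=.
by ring.
Qed.

Lemma hodge_form3 a b c d :
  hodge g (form3 a b c d) = form1 (- d) c b (- a) :> pform R 4 1.
Proof.
apply/funext => Y; rewrite /hodge inner_form3r; last first.
  exact: (@alternating_det_col R 3 1).
have detE k l m klm4 :=
  det4E (fun i j i4 j4 => @col_frameE k [:: l; m] 0 Y i j i4 j4 klm4).
rewrite !(@conform_mx_id _ 4 4) !detE //=.
by rewrite form1E /minor3 /minor2 /= !(ord1 (inord 0)); ring.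
Qed.

Lemma hodge_vol a :
  hodge g (a *: 'e^[1; 2; 3; 4] : pform R 4 4) = (fun=> a) :> pform R 4 0.
Proof.
apply/funext => Y; rewrite /hodge inner_volr; last first.
  exact: (@alternating_det_col R 4 0).
rewrite (@conform_mx_id _ 4 4) (_ : col_mx _ _ = 1%:M) ?det1 ?mulr1 //.
apply/matrixP => i j; rewrite -(inord_val i) -(inord_val j).
rewrite (@col_mx_top 3 0) // (@frameE _ [:: _; _; _]) //.
by rewrite mxE -val_eqE /= !inordK //; case: i => [[|[|[|[|]]]]].
Qed.

(** * The exterior derivative *)

Section Differential.
Variables p q r s : R.
Local Notation br := (almost_abelian_bracket (null_mx p q r s)).

(** The entries of the matrix of arguments to which the Chevalley-Eilenberg
    formula applies a form, for the pair of indices [i < j]; as a function on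
    [nat] they reduce together with the minors. *)
Definition extd_arg m (X : 'M[R]_(m.+2, 4)) (i j k l : nat)
    (z := fun a => X (inord i) (inord 3) * X (inord j) (inord a)
                 - X (inord j) (inord 3) * X (inord i) (inord a)) : R :=
  if bump j k == i then
    nth 0 [:: p * (z 1%N + z 2%N); q * z 0%N + r * (z 1%N + z 2%N);
              - q * z 0%N + s * (z 1%N + z 2%N); 0] l
  else X (inord (bump j k)) (inord l).

Lemma extd_argE m (X : 'M[R]_(m.+2, 4)) (i j : 'I_m.+2) k l :
  (k < m.+1)%N -> (l < 4)%N ->
  row' j (\matrix_(a < m.+2) if a == i then br (row i X) (row j X)
                             else row a X) (inord k) (inord l) =
  extd_arg X i j k l.
Proof.
move=> km l4; rewrite !mxE -val_eqE /= !inordK // /extd_arg; case: ifP => _.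
  rewrite !row_vec bracketE vec_inord // !inord_val.
  by congr (nth 0 [:: _; _; _; _] l); ring.
rewrite mxE; congr (X _ _); apply: val_inj; rewrite /= !inordK //.
by rewrite /bump; case: (j <= k)%N => //=; rewrite ?add1n ?add0n ltnS // ltnW.
Qed.

Lemma extd_form1 a b c d (m := p * a + r * b + s * c) :
  extd br (form1 a b c d) = form2 0 0 (q * (b - c)) 0 m m.
Proof.
apply/funext => X; rewrite (form2E _ _ _ _ _ _ (fun _ _ _ _ => erefl)).
pose F (i j : nat) := (-1) ^+ j *
  (let x := extd_arg X i j 0 in a * x 0%N + b * x 1%N + c * x 2%N + d * x 3%N).
have -> : extd br (form1 a b c d) X =
    \sum_(i < 2) \sum_(j < 2 | (i < j)%N) F i j.
  apply: eq_bigr => i _; apply: eq_bigr => j _; congr (_ * _).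
  have argE k k4 := @extd_argE 0 X i j 0 k isT k4.
  by rewrite (ord1 (inord 0)) in argE; rewrite form1E !argE.
by rewrite sum_lt2 /F /extd_arg /minor2 /= /m; ring.
Qed.

Lemma extd_form2 a b c d e f (m := - (r * a + s * b + q * d)) :
  extd br (form2 a b c d e f) = form3 0 m m (p * (a - b) - (r + s) * d).
Proof.
apply/funext => X; rewrite (form3E _ _ _ _ (fun _ _ _ _ => erefl)).
pose F (i j : nat) := (-1) ^+ j * (let y := minor2 (extd_arg X i j) in
  a * y 0 1 + b * y 0 2 + c * y 0 3 + d * y 1 2 + e * y 1 3 + f * y 2 3).
have -> : extd br (form2 a b c d e f) X =
    \sum_(i < 3) \sum_(j < 3 | (i < j)%N) F i j.
  apply: eq_bigr => i _; apply: eq_bigr => j _; congr (_ * _).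
  by apply: form2E => k l; exact: extd_argE.
by rewrite sum_lt3 /F /extd_arg /minor3 /minor2 /= /m; ring.
Qed.

Lemma extd_form3 a b c d :
  extd br (form3 a b c d) = (r + s) * a *: 'e^[1; 2; 3; 4].
Proof.
apply/funext => X.
pose F (i j : nat) := (-1) ^+ j * (let y := minor3 (extd_arg X i j) in
  a * y 0 1 2 + b * y 0 1 3 + c * y 0 2 3 + d * y 1 2 3).
have -> : extd br (form3 a b c d) X =
    \sum_(i < 4) \sum_(j < 4 | (i < j)%N) F i j.
  apply: eq_bigr => i _; apply: eq_bigr => j _; congr (_ * _).
  by apply: form3E => k l; exact: extd_argE.
have -> : ((r + s) * a *: 'e^[1; 2; 3; 4]) X = (r + s) * a * \det X.
  congr (_ * \det _); apply/matrixP => i j; rewrite mxE; congr (X i _).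
  by apply: val_inj; case: j => [[|[|[|[|]]]]] //= ?; rewrite inordK.
rewrite sum_lt4 /F /extd_arg /= (det4E (fun _ _ _ _ => erefl)).
by rewrite /minor3 /minor2 /=; ring.
Qed.

(** * The field equations *)

Lemma cov_derivE al be ga x0 x1 x2 x3 y0 y1 y2 y3 :
  cov_deriv g br (form1 al be be ga) (vec x0 x1 x2 x3) (vec y0 y1 y2 y3) =
  ga * ((p + q) / 2 * (x0 * (y1 + y2) + (x1 + x2) * y0)
        + r * x1 * y1 - s * x2 * y2 + (r - s) / 2 * (x1 * y2 + x2 * y1))
  + (al * (p + q) + be * (r + s)) / 2 * (x1 + x2) * y3
  - (al * (p - q) + be * (r + s)) / 2 * x3 * (y1 + y2).
Proof. by rewrite /cov_deriv nablaE form1E !vecE; field. Qed.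

Lemma circE a b x0 x1 x2 x3 y0 y1 y2 y3 :
  circ g (form3 0 a a b) (vec x0 x1 x2 x3) (vec y0 y1 y2 y3) =
  a * b * (x0 * (y1 + y2) + (x1 + x2) * y0)
  - a ^+ 2 * ((x1 + x2) * (y1 + y2))
  + b ^+ 2 * (x1 * y1 - x2 * y2 - x3 * y3).
Proof. by rewrite /circ !interior_form3 inner_form2; ring. Qed.

Lemma gauge_equationE al be ga a b
    (m := b * p - a * (r + s) - a * ga) (k := a * al + b * be) :
  codiff g br (form3 0 a a b)
    + interior (sharp g (form1 al be be ga)) (form3 0 a a b) =
  form2 m m 0 (- (b * ga)) k k.
Proof.
rewrite sharp_form1 interior_form3.
have -> : codiff g br (form3 0 a a b) =
    - hodge g (extd br (hodge g (form3 0 a a b) : pform R 4 1)) by [].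
rewrite hodge_form3 extd_form1 hodge_form2; apply/funext => X.
rewrite -[LHS]/(- form2 _ _ _ _ _ _ X + form2 _ _ _ _ _ _ X).
rewrite !(form2E _ _ _ _ _ _ (fun _ _ _ _ => erefl)) /m /k.
by ring.
Qed.

Lemma dilaton_equationE al be ga a b :
  codiff g br (form1 al be be ga) 0
    + inner g (form1 al be be ga) (form1 al be be ga)
    - inner g (form3 0 a a b) (form3 0 a a b) =
  - (ga * (r + s)) + al ^+ 2 - ga ^+ 2 - b ^+ 2.
Proof.
have -> : codiff g br (form1 al be be ga) =
    - hodge g (extd br (hodge g (form1 al be be ga) : pform R 4 3)) by [].
rewrite hodge_form1 extd_form3 hodge_vol inner_form1 inner_form3.
by rewrite -[(- _) 0]/(- ((r + s) * ga)); ring.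
Qed.

Lemma form2_eq0 (a b c d e f : R) : form2 a b c d e f = 0 ->
  [/\ a = 0, b = 0, c = 0, d = 0 & e = 0 /\ f = 0].
Proof.
move=> F0; have {}F0 X : form2 a b c d e f X = 0 by rewrite F0.
have := (F0 (frame [:: 1; 2]), F0 (frame [:: 1; 3]), F0 (frame [:: 1; 4]),
  (F0 (frame [:: 2; 3]), F0 (frame [:: 2; 4]), F0 (frame [:: 3; 4]))).
have frE k l kl4 := form2E a b c d e f
  (fun i j i2 j4 => @frameE k [:: l] i j i2 j4 kl4).
rewrite !frE // /minor2 /= !(mul0r, mulr0, mulr1, oppr0, add0r, addr0).
by move=> [[[-> ->] ->] [[-> ->] ->]].
Qed.

Lemma form1_inj (a b c d a' b' c' d' : R) : form1 a b c d = form1 a' b' c' d' ->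
  [/\ a = a', b = b', c = c' & d = d'].
Proof.
move=> /(congr1 (sharp g)); rewrite !sharp_form1 => v.
split; [have := congr1 (fun x : 'rV_4 => x#0) v
  | have := congr1 (fun x : 'rV_4 => x#1) v
  | have := congr1 (fun x : 'rV_4 => x#2) v
  | have := congr1 (fun x : 'rV_4 => x#3) v]; rewrite !vecE //; exact: oppr_inj.
Qed.

(** Once the second equation holds, the left-hand side of the Einstein equation
    is a multiple of the square of [e^2 + e^3], by the factor
    [p ^+ 2 + (r - s) * u], and the scalar equation holds identically. *)
Lemma solves_iff al be (u := r + s) : u != 0 -> p * al + u * be = 0 ->
  solves g br (form1 al be be (al + u))
    (form3 0 (- (p + q)) (- (p + q)) (- u)) <->
  [/\ q = 0, al = - u, be = p & p ^+ 2 + (r - s) * u = 0].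
Proof.
move=> u0 h; split=> [[ric gauge _]|[q0 alu bep h']].
  move: gauge; rewrite gauge_equationE => /form2_eq0 [m0 _ _ ga0 _].
  have alu : al = - u.
    by apply: (mulfI u0); rewrite -[RHS]addr0 -ga0; ring.
  have q0 : q = 0.
    by apply: (mulfI u0); rewrite mulr0 -m0 alu -/u; ring.
  have bep : be = p.
    by apply: (mulfI u0); rewrite -[RHS]addr0 -h alu; ring.
  split=> //; have := ric (vec 0 1 0 0) (vec 0 0 1 0).
  rewrite ricciE cov_derivE circE => ric23.
  by rewrite -ric23 alu q0 /u; field.
split=> [x y||].
- rewrite (vec_coord x) (vec_coord y) ricciE cov_derivE circE alu q0 bep.
  transitivity ((p ^+ 2 + (r - s) * u) * ((x#1 + x#2) * (y#1 + y#2))).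
    by rewrite /u; field.
  by rewrite h' mul0r.
- rewrite gauge_equationE alu q0 bep; apply/funext => X.
  by rewrite (form2E _ _ _ _ _ _ (fun _ _ _ _ => erefl)) /u -[RHS]/0; ring.
by rewrite dilaton_equationE alu /u; ring.
Qed.

End Differential.

(** * The isomorphism type *)

Lemma aff_bracket_formula (u v : 'rV[R]_2) :
  aff_bracket u v = u 0 0 *: v - v 0 0 *: u.
Proof.
have mulE (x y : 'rV[R]_(1 + 1)) : x *m aff_mx y = x 0 0 *: y.
  rewrite -{1}[x]hsubmxK mul_row_col mulmx0 addr0.
  apply/rowP => j; rewrite !mxE big_ord1 !mxE; congr (x _ _ * y _ _).
  exact: val_inj.
rewrite /aff_bracket linearB /= {1 3}/aff_mx !mul_col_mx !col_mxKu.
by rewrite !mulE.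
Qed.

(** The functionals [u x_1 - p (x_2 + x_3)] and [s x_2 - r x_3] vanish on the
    derived algebra, and together with [u x_4], [x_2 + x_3] they form a
    coordinate system; the latter two are the coordinates of the affine factor. *)
Lemma null_mx_isomorphic p r s : r + s != 0 ->
  lie_isomorphic (almost_abelian_bracket (null_mx p 0 r s))
    (abelian_sum_bracket (U := 'rV[R]_2) (@aff_bracket R)).
Proof.
move=> u0; pose u := r + s.
pose pair (a b : R) : 'rV[R]_2 := \row_i nth 0 [:: a; b] i.
pose f (x : 'rV[R]_4) : 'rV[R]_2 * 'rV[R]_2 :=
  (pair (u * x#0 - p * (x#1 + x#2)) (s * x#1 - r * x#2),
   pair (u * x#3) (x#1 + x#2)).
pose f' (z : 'rV[R]_2 * 'rV[R]_2) : 'rV[R]_4 :=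
  vec ((z.1#0 + p * z.2#1) / u) ((z.1#1 + r * z.2#1) / u)
      ((s * z.2#1 - z.1#1) / u) (z.2#0 / u).
have pair_inord a b k : (k < 2)%N -> (pair a b)#k = nth 0 [:: a; b] k.
  by move=> k2; rewrite mxE inordK.
have pair_coord (z : 'rV[R]_2) : z = pair z#0 z#1.
  apply/rowP => i; rewrite -(inord_val i).
  by case: i => [[|[|]]] // i2; rewrite /= pair_inord.
have f_lin : linear f.
  move=> k x y; rewrite /f; congr (_, _).
    by rewrite [RHS]pair_coord; congr pair;
       rewrite [RHS]mxE [X in _ = X + _]mxE !pair_inord //= !mxE; ring.
  by rewrite [RHS]pair_coord; congr pair;
     rewrite [RHS]mxE [X in _ = X + _]mxE !pair_inord //= !mxE; ring.
pose F : {linear 'rV[R]_4 -> ('rV[R]_2 * 'rV[R]_2)%type} :=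
  HB.pack f (GRing.isLinear.Build _ _ _ _ f f_lin).
exists F; rewrite /F /=; split.
  exists f' => [x|[z w]]; rewrite /f' /f /= ?vecE ?pair_inord //=.
    by rewrite [RHS]vec_coord; congr vec; rewrite /u; field.
  rewrite [in RHS](pair_coord z) [in RHS](pair_coord w).
  by congr (pair _ _, pair _ _); rewrite /u; field.
move=> x y; rewrite (vec_coord x) (vec_coord y) bracketE /f !vecE.
rewrite /abelian_sum_bracket /= aff_bracket_formula; congr (_, _).
  by rewrite [RHS]pair_coord !mxE; congr pair; rewrite /u; ring.
by rewrite [RHS]pair_coord; congr pair; rewrite !mxE ?inordK //= /u; ring.
Qed.

End Coordinates.

Theorem theorem4p19 (R : realType) (d11 d12 d21 d22 d32 phi1 phi2 : R)
    (D : 'M[R]_3) (phi : pform R 4 1) (H : pform R 4 3) :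
  let br := almost_abelian_bracket D in
  let g := neutral_metric R in
  D = mx33 [:: [:: d11; d12; d12];
               [:: d21; d22; - d11 + d22];
               [:: - d21; d32; d11 + d32]] ->
  phi = phi1 *: 'e^[1] + phi2 *: ('e^[2] + 'e^[3])
        + (phi1 + d11 + d22 + d32) *: 'e^[4] ->
  H = (2 * d11) *: 'e^[1; 2; 3] - (d12 + d21) *: ('e^[1; 2; 4] + 'e^[1; 3; 4])
      + (d11 - d22 - d32) *: 'e^[2; 3; 4] ->
  d11 * \tr D = 0 ->
  d11 * phi1 = 0 ->
  d12 * phi1 + (d22 + d32) * phi2 = 0 ->
  ~ abelian_bracket br ->
  ~ unimodular br ->
  phi <> 0 ->
  H <> 0 ->
  (solves g br phi H <->
   exists t : R,
     [/\ t != 0,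
         D = mx33 [:: [:: 0; d12; d12];
                      [:: 0; (t ^+ 2 - d12 ^+ 2) / (2 * t);
                             (t ^+ 2 - d12 ^+ 2) / (2 * t)];
                      [:: 0; (t ^+ 2 + d12 ^+ 2) / (2 * t);
                             (t ^+ 2 + d12 ^+ 2) / (2 * t)]],
         phi = - t *: 'e^[1] + d12 *: ('e^[2] + 'e^[3]),
         H = - d12 *: ('e^[1; 2; 4] + 'e^[1; 3; 4]) - t *: 'e^[2; 3; 4]
       & H = extd br ('e^[2; 3] + (d12 / t) *: ('e^[1; 2] + 'e^[1; 3]))]) /\
  (solves g br phi H ->
   lie_isomorphic br (abelian_sum_bracket (U := 'rV[R]_2) (@aff_bracket R))).
Proof.
move=> br g DE phiE HE trD _ h _ nu _ _.
have d11_0 : d11 = 0.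
  move/eqP: trD; rewrite mulf_eq0 => /orP[/eqP //|/eqP trD0].
  by case: nu; apply/almost_abelian_unimodular.
have {}DE : D = null_mx d12 d21 d22 d32.
  by rewrite DE d11_0 oppr0 !add0r.
have u0 : d22 + d32 != 0.
  rewrite -(null_mx_trace d12 d21) -DE; apply/eqP => trD0.
  by case: nu; apply/almost_abelian_unimodular.
have {}phiE : phi = form1 phi1 phi2 phi2 (phi1 + (d22 + d32)).
  by rewrite phiE d11_0 addr0 scalerDr !addrA.
have {}HE : H = form3 0 (- (d12 + d21)) (- (d12 + d21)) (- (d22 + d32)).
  rewrite HE d11_0 mulr0 sub0r -scaleNr scalerDr !addrA /form3.
  by rewrite -opprD.
have solvesE := solves_iff d21 u0 h.
rewrite -DE -HE -phiE -/br -/g in solvesE.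
split; last first.
  by case/solvesE=> q0 _ _ _; rewrite /br DE q0; exact: null_mx_isomorphic.
rewrite solvesE; split=> [[q0 phi1E phi2E h']|[t [t0 tD tphi _ _]]].
  have u2 : 2 * (d22 + d32) != 0 by rewrite mulf_neq0 // pnatr_eq0.
  have d22E : d22 = ((d22 + d32) ^+ 2 - d12 ^+ 2) / (2 * (d22 + d32)).
    by apply: (mulIf u2); rewrite divfK // -[RHS]addr0 -h'; ring.
  have d32E : d32 = ((d22 + d32) ^+ 2 + d12 ^+ 2) / (2 * (d22 + d32)).
    by apply: (mulIf u2); rewrite divfK // -[RHS]subr0 -h'; ring.
  exists (d22 + d32); split=> //.
  - by rewrite DE q0 /null_mx oppr0 -d22E -d32E.
  - by rewrite phiE phi1E phi2E addNr /form1 scale0r addr0 scalerDr addrA.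
  - by rewrite HE q0 addr0 /form3 scale0r add0r scalerDr -[in RHS]scaleNr.
  rewrite HE /br DE q0.
  have -> : 'e^[2; 3] + (d12 / (d22 + d32)) *: ('e^[1; 2] + 'e^[1; 3]) =
      form2 (d12 / (d22 + d32)) (d12 / (d22 + d32)) 0 1 0 0.
    by rewrite [LHS]addrC scalerDr /form2 !scale0r !addr0 scale1r.
  by rewrite extd_form2; congr form3; field.
have [alt bet _ ga0] : [/\ phi1 = - t, phi2 = d12, phi2 = d12
                         & phi1 + (d22 + d32) = 0].
  apply: form1_inj; rewrite -phiE tphi /form1 scale0r addr0.
  by rewrite scalerDr addrA.
have ut : d22 + d32 = t by apply/eqP; rewrite -subr_eq0 -ga0 alt addrC.
have entry i j :=
  congr1 (fun M : 'M_3 => M (inord i) (inord j)) (etrans (esym DE) tD).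
have := (entry 1%N 0%N, entry 1%N 1%N, entry 2%N 1%N).
rewrite !mxE !inordK //= => -[[d21_0 d22E] d32E].
by split=> //; rewrite ?alt ut // d22E d32E; field.
Qed.
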